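(* Let $k$ be a positive integer, let $u\in S$ be a $k$-bounded monomial, and let $I=B_k(u)$ be the principal $k$-Borel ideal with $k$-Borel generator $u$. Then $I$ is sortable.
   Context: Throughout, $n\ge 3$ is an integer, $K$ is a field and $S=K[x_1,\ldots,x_n]$ is the polynomial ring. For a monomial ideal $I\subset S$, $G(I)$ is its unique minimal set of monomial generators; $I$ is equigenerated if all elements of $G(I)$ have the same degree. For a monomial $u$, $\mathrm{supp}(u)=\{i:x_i\mid u\}$. Let $k$ be a positive integer. A monomial $x_1^{a_1}\cdots x_n^{a_n}$ is $k$-bounded if $a_i\le k$ for all $i$. A monomial ideal $I$ generated by $k$-bounded monomials is $k$-Borel if for every $k$-bounded monomial $u\in I$, every $j\in\mathrm{supp}(u)$ and every $i<j$ one has $x_i(u/x_j)\in I$ provided $x_i(u/x_j)$ is again $k$-bounded. For a $k$-bounded monomial $u$, $B_k(u)$ is the unique smallest (with respect to inclusion) $k$-Borel ideal containing $u$. Sorting: for monomials $u,v$ of the same degree $d$, write $uv=x_{i_1}x_{i_2}\cdots x_{i_{2d}}$ with $i_1\le i_2\le\cdots\le i_{2d}$ and put $u'=x_{i_1}x_{i_3}\cdots x_{i_{2d-1}}$, $v'=x_{i_2}x_{i_4}\cdots x_{i_{2d}}$; set $\mathrm{sort}(u,v)=(u',v')$. A set $B$ of monomials of degree $d$ is sortable if $\mathrm{sort}(B\times B)\subset B\times B$. An equigenerated monomial ideal $I$ is sortable if $G(I)$ is a sortable set. *)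

(* Defs.v *)
From HB Require Import structures.
From mathcomp Require Import all_boot all_order all_algebra.
From mathcomp Require Import boolp classical_sets.
From mathcomp Require Import mpoly.

Set Implicit Arguments.
Unset Strict Implicit.
Unset Printing Implicit Defensive.

Import GRing.Theory.

Local Open Scope classical_set_scope.
Local Open Scope ring_scope.

(* Not necessarily proper, unlike idealr_closed: the unit ideal B_k(1) must
   be allowed. *)
Definition is_ideal (R : comNzRingType) (I : set R) : Prop :=
  [/\ I 0, (forall p q, I p -> I q -> I (p + q))
    & forall a p, I p -> I (a * p)].

(* Monomials are represented by their exponent vectors in 'X_{1..n}. *)
Definition mgen (K : fieldType) (n : nat) (A : set 'X_{1..n}) :
    set {mpoly K[n]} :=
  smallest (@is_ideal {mpoly K[n]}) [set 'X_[m] | m in A].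

Arguments mgen K {n} A _.

(* G is the set G(I), see min_gens_unique. *)
Definition is_min_gens (K : fieldType) (n : nat) (I : set {mpoly K[n]})
    (G : set 'X_{1..n}) : Prop :=
  I = mgen K G /\ forall B, B `<=` G -> I = mgen K B -> B = G.

Definition kbounded (n k : nat) (m : 'X_{1..n}) : Prop :=
  forall i, (m i <= k)%N.

Definition is_kBorel (K : fieldType) (n k : nat) (I : set {mpoly K[n]}) :
    Prop :=
  (exists2 A : set 'X_{1..n}, A `<=` kbounded k & I = mgen K A) /\
  forall (m : 'X_{1..n}) (i j : 'I_n),
    kbounded k m -> I 'X_[m] -> m j != 0%N -> (i < j)%N ->
    kbounded k (U_(i) + (m - U_(j)))%MM ->
    I 'X_[(U_(i) + (m - U_(j)))].

(* [smallest] is an intersection; is_kBorel_Bk shows that it is k-Borel. *)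
Definition Bk (K : fieldType) (n k : nat) (u : 'X_{1..n}) :
    set {mpoly K[n]} :=
  smallest (is_kBorel k) [set 'X_[u]].

Arguments Bk K {n} k u _.

(* i_1 <= i_2 <= ... with x_(i_1) x_(i_2) ... the given monomial. *)
Definition mnm_seq (n : nat) (m : 'X_{1..n}) : seq 'I_n :=
  flatten [seq nseq (m i) i | i <- enum 'I_n].

Definition seq_mnm (n : nat) (s : seq 'I_n) : 'X_{1..n} :=
  (\sum_(i <- s) U_(i))%MM.

(* Positions are counted from 0 here: the first component collects the
   positions 0, 2, 4, ..., i.e. i_1, i_3, i_5, ... *)
Definition sort_pair (n : nat) (u v : 'X_{1..n}) : 'X_{1..n} * 'X_{1..n} :=
  let s := mnm_seq (u + v)%MM in
  (seq_mnm (mask (mkseq (fun t => ~~ odd t) (size s)) s),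
   seq_mnm (mask (mkseq odd (size s)) s)).

Definition equigenerated_in (n d : nat) (B : set 'X_{1..n}) : Prop :=
  forall m, B m -> mdeg m = d.

Definition sortable_set (n : nat) (B : set 'X_{1..n}) : Prop :=
  forall u v, B u -> B v -> B (sort_pair u v).1 /\ B (sort_pair u v).2.

Definition sortable_ideal (K : fieldType) (n : nat) (I : set {mpoly K[n]}) :
    Prop :=
  exists2 G, is_min_gens I G
  & (exists d, equigenerated_in d G) /\ sortable_set G.

Lemma is_ideal_mgen (K : fieldType) (n : nat) (A : set 'X_{1..n}) :
  is_ideal (mgen K A).
Proof.
split.
- by move=> J [[]].
- move=> p q Ip Iq J [idJ AJ]; case: (idJ) => _ JD _.
  by apply: JD; [apply: Ip | apply: Iq].
- move=> a p Ip J [idJ AJ]; case: (idJ) => _ _ JM.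
  by apply: JM; apply: Ip.
Qed.

Lemma mgenP (K : fieldType) (n : nat) (A : set 'X_{1..n})
    (p : {mpoly K[n]}) :
  mgen K A p <->
  forall m, m \in msupp p -> exists2 a, A a & (a <= m)%MM.
Proof.
split=> [Ap|Hp].
  apply: (Ap [set q : {mpoly K[n]} |
    forall m, m \in msupp q -> exists2 a, A a & (a <= m)%MM]).
  split; last first.
    move=> _ [a Aa <-] m; rewrite msuppX inE => /eqP->.
    by exists a => //; apply: lepm_refl.
  split.
  - by move=> m; rewrite msupp0.
  - move=> q r Hq Hr m /msuppD_le; rewrite mem_cat => /orP[]; first exact: Hq.
    exact: Hr.
  - move=> q r Hr m /msuppM_le /allpairsP[[m1 m2] /= [_ m2r ->]].
    have [a Aa le_am] := Hr _ m2r; exists a => //.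
    by apply: lepm_trans le_am _; apply/lem_addl.
have [I0 ID IM] := is_ideal_mgen K A.
rewrite (mpolyE p) big_seq; apply: big_ind => // m /Hp [a Aa le_am].
rewrite -mul_mpolyC; apply: (IM); rewrite -(submK le_am) mpolyXD; apply: IM.
by move=> J [_ AJ]; apply: AJ; exists a.
Qed.

Lemma mgenXP (K : fieldType) (n : nat) (A : set 'X_{1..n}) (m : 'X_{1..n}) :
  mgen K A 'X_[m] <-> exists2 a, A a & (a <= m)%MM.
Proof.
rewrite mgenP; split=> [|Hm m']; last by rewrite msuppX inE => /eqP->.
by apply; rewrite msuppX inE.
Qed.

Lemma min_gens_unique (K : fieldType) (n : nat) (I : set {mpoly K[n]})
    (G H : set 'X_{1..n}) :
  is_min_gens I G -> is_min_gens I H -> G = H.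
Proof.
suff sub G1 G2 : is_min_gens I G1 -> is_min_gens I G2 -> G1 `<=` G2.
  by move=> minG minH; apply/seteqP; split; apply: sub.
move=> [IG1 minG1] [IG2 _] m G1m.
have IE m1 : I 'X_[m1] <-> exists2 a, G1 a & (a <= m1)%MM.
  by rewrite IG1; apply: mgenXP.
have IE2 m1 : I 'X_[m1] <-> exists2 a, G2 a & (a <= m1)%MM.
  by rewrite IG2; apply: mgenXP.
have [a G2a le_am] : exists2 a, G2 a & (a <= m)%MM.
  by apply/IE2/IE; exists m => //; apply: lepm_refl.
have [b G1b le_ba] : exists2 b, G1 b & (b <= a)%MM.
  by apply/IE/IE2; exists a => //; apply: lepm_refl.
have [eq_bm|ne_bm] := eqVneq b m.
  suff -> : m = a by [].
  apply/mnmP => i; apply/eqP; rewrite eqn_leq.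
  by rewrite (elimT mnm_lepP le_am) andbT -eq_bm (elimT mnm_lepP le_ba).
suff eqB : G1 `\ m = G1 by move: G1m; rewrite -eqB => -[_ /(_ erefl)].
apply: minG1; first by move=> x [].
rewrite IG1; apply/seteqP; split=> p /mgenP Hp; apply/mgenP => c /Hp [x G1x le_xc].
  have [eq_xm|/eqP ne_xm] := eqVneq x m; last by exists x.
  exists b; first by split=> //; apply/eqP.
  by apply: lepm_trans le_ba (lepm_trans le_am _); rewrite -eq_xm.
by exists x => //; case: G1x.
Qed.

Lemma is_kBorel_Bk (K : fieldType) (n k : nat) (u : 'X_{1..n}) :
  is_kBorel k (Bk K k u).
Proof.
split; last first.
  move=> m i j bm Im mj ij bm' J [BJ uJ]; case: (BJ) => _; apply=> //.
  exact: Im.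
exists [set m | kbounded k m /\ Bk K k u 'X_[m]]; first by move=> m [].
apply/seteqP; split=> p.
  move=> Ip; apply/mgenP => m mp; pose m' := [multinom minn (m i) k | i < n].
  exists m'; last by apply/mnm_lepP => i; rewrite mnmE geq_minl.
  split=> [i|J BJ]; first by rewrite mnmE geq_minr.
  have := Ip J BJ; case: BJ => -[[A Ab ->] _ _] /mgenP/(_ m mp) [a Aa le_am].
  apply/mgenXP; exists a => //; apply/mnm_lepP => i.
  by rewrite mnmE leq_min (elimT mnm_lepP le_am) Ab.
move=> Ap J BJ; apply: Ap; split; last by move=> _ [m [_ Im] <-]; apply: Im.
by case: BJ => -[[A _ ->] _ _]; apply: is_ideal_mgen.
Qed.

(* Main.v *)
Require Import Defs.
From mathcomp Require Import all_boot all_order all_algebra.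
From mathcomp Require Import boolp classical_sets.
From mathcomp Require Import mpoly.
From mathcomp Require Import zify.

(** Order the exponents by the variables and record a monomial [m] through its
    cumulative degrees, the degree of [m] in the first [t] variables.  A Borel
    move [x_i (m / x_j)] with [i < j] can only raise these numbers, so every
    monomial reached from [u] by such moves lies in the set of [k]-bounded
    monomials of the degree of [u] whose cumulative degrees dominate those of
    [u].  The converse holds too ([dominating_in_kBorel]): a monomial of this
    set other than [u] has a first variable [x_j] in which it falls short of
    [u], hence an earlier variable [x_i] in which it exceeds [u], and replacing
    one [x_i] by [x_j] stays in the set and comes closer to [u].  The minimal
    generators of [B_k(u)] are therefore exactly this dominating set
    ([BkE], [min_gens_mgen]).

    In these terms sorting is transparent.  Since the letters of [v w] are
    listed in increasing order, those below a threshold form an initial segment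
    of the list, and picking every other letter halves its length: the
    cumulative degrees of the two components of the sort of [(v, w)] are the
    halves, rounded up and down, of those of [v w] ([cumdeg_sort1],
    [cumdeg_sort2]).  Rounded halving is monotone, which gives domination and
    the degree, and it turns an increment of at most [2 k] into one of at most
    [k], which gives [k]-boundedness. *)

Local Open Scope classical_set_scope.
Local Open Scope nat_scope.

(** * Cumulative degrees *)

Definition cumdeg {n : nat} (m : 'X_{1..n}) (t : nat) : nat :=
  \sum_(i < n | i < t) m i.

Lemma cumdegS {n : nat} (m : 'X_{1..n}) (i : 'I_n) :
  cumdeg m i.+1 = cumdeg m i + m i.
Proof.
rewrite /cumdeg (bigD1 i) //= addnC; congr (_ + _).
by apply: eq_bigl => j; rewrite ltnS [in RHS]ltn_neqAle andbC.
Qed.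

Lemma cumdeg_mdeg {n : nat} (m : 'X_{1..n}) : cumdeg m n = mdeg m.
Proof. by rewrite mdegE; apply: eq_bigl => i; rewrite ltn_ord. Qed.

Lemma cumdeg0 {n : nat} (t : nat) : cumdeg (0%MM : 'X_{1..n}) t = 0.
Proof. by rewrite /cumdeg big1 // => i _; rewrite mnm0E. Qed.

Lemma cumdegD {n : nat} (a b : 'X_{1..n}) (t : nat) :
  cumdeg (a + b)%MM t = cumdeg a t + cumdeg b t.
Proof. by rewrite /cumdeg -big_split; apply: eq_bigr => i _; rewrite mnmDE. Qed.

Lemma cumdegU {n : nat} (i : 'I_n) (t : nat) : cumdeg U_(i)%MM t = (i < t).
Proof.
rewrite /cumdeg; under eq_bigr do rewrite mnm1E.
have [lt_it|ge_it] := boolP (i < t).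
  by rewrite (bigD1 i) //= eqxx big1 ?addn0 // => j /andP[_]; rewrite eq_sym => /negbTE->.
rewrite big1 // => j lt_jt; case: eqP => // eq_ij.
by rewrite eq_ij lt_jt in ge_it.
Qed.

Lemma leq_cumdeg {n : nat} (a b : 'X_{1..n}) (t : nat) :
  (forall i : 'I_n, i < t -> a i <= b i) -> cumdeg a t <= cumdeg b t.
Proof. by move=> le_ab; apply: leq_sum. Qed.

Lemma ltn_cumdeg_ex {n : nat} (a b : 'X_{1..n}) (t : nat) :
  cumdeg a t < cumdeg b t -> exists2 i : 'I_n, i < t & a i < b i.
Proof.
move=> lt_ab; have [/existsP[i /andP[]]|] := boolP [exists i : 'I_n, (i < t) && (a i < b i)].
  by exists i.
rewrite negb_exists => /forallP noi; move: lt_ab; rewrite ltnNge leq_cumdeg // => i lt_it.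
by have := noi i; rewrite lt_it /= -leqNgt.
Qed.

Lemma ltn_cumdeg {n : nat} (a b : 'X_{1..n}) (t : nat) (i : 'I_n) :
  (forall l : 'I_n, l < t -> a l <= b l) -> i < t -> a i < b i ->
  cumdeg a t < cumdeg b t.
Proof.
move=> le_ab lt_it lt_i; rewrite /cumdeg (bigD1 i) //= [X in _ < X](bigD1 i) //=.
by rewrite -addSn leq_add // leq_sum // => l /andP[/le_ab].
Qed.

Lemma lepm_mdeg_eq {n : nat} (a b : 'X_{1..n}) :
  (a <= b)%MM -> mdeg a = mdeg b -> a = b.
Proof.
move=> le_ab; rewrite -{1 2}(submK le_ab) mdegD => eq_deg.
have /eqP : mdeg (b - a)%MM = 0 by lia.
by rewrite mdeg_eq0 => /eqP ->; rewrite add0m.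
Qed.

(** * Borel moves *)

Definition borel_move {n : nat} (i j : 'I_n) (m : 'X_{1..n}) : 'X_{1..n} :=
  (U_(i) + (m - U_(j)))%MM.

Lemma borel_moveE {n : nat} (i j : 'I_n) (m : 'X_{1..n}) (l : 'I_n) :
  borel_move i j m l = (i == l) + (m l - (j == l)).
Proof. by rewrite mnmDE mnmBE !mnm1E. Qed.

Lemma cumdeg_borel_move {n : nat} (i j : 'I_n) (m : 'X_{1..n}) (t : nat) :
  m j != 0 -> cumdeg (borel_move i j m) t + (j < t) = cumdeg m t + (i < t).
Proof.
move=> mj; rewrite -(cumdegU j) cumdegD cumdegU -addnA -cumdegD submK; first exact: addnC.
by apply/mnm_lepP => l; rewrite mnm1E; case: eqP => // <-; rewrite lt0n.
Qed.

Lemma mdeg_borel_move {n : nat} (i j : 'I_n) (m : 'X_{1..n}) :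
  m j != 0 -> mdeg (borel_move i j m) = mdeg m.
Proof.
by move=> /(cumdeg_borel_move i j m n); rewrite !ltn_ord !cumdeg_mdeg; lia.
Qed.

Lemma borel_moveK {n : nat} (i j : 'I_n) (m : 'X_{1..n}) :
  i != j -> m i != 0 -> borel_move i j (borel_move j i m) = m.
Proof.
move=> ne_ij mi; apply/mnmP => l; rewrite !borel_moveE.
have [eq_il|_] := eqVneq i l; last by case: eqVneq; lia.
by rewrite -eq_il eq_sym (negbTE ne_ij); lia.
Qed.

(** * The dominating set generates the principal k-Borel ideal *)

Definition dominating {n : nat} (k : nat) (u : 'X_{1..n}) : set 'X_{1..n} :=
  [set m | [/\ kbounded k m, mdeg m = mdeg u
             & forall t, cumdeg u t <= cumdeg m t]].

Lemma dominating_refl {n k : nat} {u : 'X_{1..n}} :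
  kbounded k u -> dominating k u u.
Proof. by []. Qed.

(** A move that does not destroy divisibility by the generator [a] costs
    nothing; otherwise [a] and [m] have the same exponent at [j], and the same
    move applied to [a] gives a generator dividing the moved [m]. *)
Lemma is_kBorel_dominating (K : fieldType) {n : nat} (k : nat) (u : 'X_{1..n}) :
  is_kBorel k (mgen K (dominating k u)).
Proof.
split; first by exists (dominating k u) => // m [].
move=> m i j bm /mgenXP[a [ba da ca] /mnm_lepP le_am] mj lt_ij bm'.
have ne_ij : i != j by apply: contraTneq lt_ij => ->; rewrite ltnn.
apply/mgenXP; have [lt_aj|ge_aj] := ltnP (a j) (m j).
  exists a; first by [].
  apply/mnm_lepP => l; rewrite -/(borel_move i j m) borel_moveE.
  have := le_am l; have [<-|_] := eqVneq j l; lia.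
have aj : a j != 0 by have := le_am j; lia.
exists (borel_move i j a); last first.
  apply/mnm_lepP => l; rewrite -/(borel_move i j m) !borel_moveE.
  by have := le_am l; lia.
split; last 2 first.
- by rewrite mdeg_borel_move.
- by move=> t; have := cumdeg_borel_move i j a t aj; have := ca t; lia.
move=> l; have := bm' l; rewrite -/(borel_move i j m) !borel_moveE.
by have := le_am l; lia.
Qed.

(** One step from [m] towards [u].  All exponents before the first deficit [j]
    are at least those of [u], so between an excess [i < j] and [j] the
    cumulative degrees of [m] are strictly larger than those of [u]: the
    inverse move keeps domination. *)
Lemma dominating_step {n k : nat} {u m : 'X_{1..n}} :
  kbounded k u -> dominating k u m -> m <> u ->
  exists i j : 'I_n, [/\ i < j, u i < m i, m j < u j
                       & dominating k u (borel_move j i m)].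
Proof.
move=> bu [bm dm cm] ne_mu.
have [j0 lt_j0] : exists j, m j < u j.
  apply/existsP; apply: contra_notT ne_mu; rewrite negb_exists => /forallP ge_mu.
  by apply/esym/lepm_mdeg_eq => //; apply/mnm_lepP => j; rewrite leqNgt.
case: (arg_minnP (fun j : 'I_n => j : nat) (P := fun j => m j < u j) lt_j0).
move=> j lt_j min_j.
have le_um (l : 'I_n) : l < j -> u l <= m l.
  by move=> lt_lj; rewrite leqNgt; apply/negP => /min_j; rewrite leqNgt lt_lj.
have [i lt_ij lt_i] : exists2 i : 'I_n, i < j & u i < m i.
  by apply: ltn_cumdeg_ex; have := cm j.+1; rewrite !cumdegS; lia.
have mi : m i != 0 by lia.
exists i, j; split=> //; split.
- move=> l; rewrite borel_moveE; have := bm l; have := bu l.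
  by have [<-|_] := eqVneq j l; lia.
- by rewrite mdeg_borel_move.
move=> t; have := cumdeg_borel_move j i m t mi; have := cm t.
have [le_tj|] := leqP t j; last by lia.
have [lt_it|] := ltnP i t; last by lia.
have : cumdeg u t < cumdeg m t.
  by apply: (ltn_cumdeg _ _ _ i) => // l lt_lt; apply: le_um; lia.
lia.
Qed.

(** Induction on the degree of the truncated difference [m - u]; a step
    towards [u] removes one unit from it, since it takes from an excess and
    gives to a deficit. *)
Lemma dominating_in_kBorel (K : fieldType) {n k : nat} {u m : 'X_{1..n}}
    (J : set {mpoly K[n]}) :
  kbounded k u -> is_kBorel k J -> J 'X_[u] -> dominating k u m -> J 'X_[m].
Proof.
move=> bu [_ BJ] Ju; have [d] := ubnP (mdeg (m - u)%MM).
elim: d m => // d IHd m lt_d Dm.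
have [->//|/eqP ne_mu] := eqVneq m u.
have [i [j [lt_ij lt_i lt_j Dm1]]] := dominating_step bu Dm ne_mu.
have ne_ij : i != j by apply: contraTneq lt_ij => ->; rewrite ltnn.
have mi : m i != 0 by lia.
have mE := borel_moveK i j m ne_ij mi.
have [bm _ _] := Dm; have [bm1 _ _] := Dm1.
rewrite -mE; apply: BJ => //.
- apply: IHd => //; suff : mdeg (borel_move j i m - u)%MM < mdeg (m - u)%MM by lia.
  rewrite -!cumdeg_mdeg; apply: (ltn_cumdeg _ _ _ i) => // [l _|];
    rewrite !mnmBE borel_moveE.
    by have [<-|_] := eqVneq j l; lia.
  by rewrite eqxx eq_sym (negbTE ne_ij); lia.
- by rewrite borel_moveE eqxx.
- by rewrite -/(borel_move i j (borel_move j i m)) mE.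
Qed.

Lemma BkE (K : fieldType) {n k : nat} {u : 'X_{1..n}} :
  kbounded k u -> Bk K k u = mgen K (dominating k u).
Proof.
move=> bu; apply/seteqP; split=> [p|p Dp J [BJ uJ]].
  apply; split; first exact: is_kBorel_dominating.
  move=> _ ->; apply/mgenXP; exists u; first exact: dominating_refl.
  exact: lepm_refl.
apply: Dp; split=> [|_ [m Dm <-]]; last first.
  by apply: (dominating_in_kBorel K J bu BJ _ Dm); apply: uJ.
by case: BJ => [[A _ ->] _]; apply: is_ideal_mgen.
Qed.

(** Monomials of equal degree never properly divide one another. *)
Lemma min_gens_mgen (K : fieldType) {n d : nat} {G : set 'X_{1..n}} :
  equigenerated_in d G -> is_min_gens (mgen K G) G.
Proof.
move=> dG; split=> // B sBG eqGB; apply/seteqP; split=> // m Gm.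
have : mgen K G 'X_[m] by apply/mgenXP; exists m => //; apply: lepm_refl.
rewrite eqGB => /mgenXP[a Ba le_am].
by rewrite -(lepm_mdeg_eq a m le_am) // (dG _ (sBG _ Ba)) (dG _ Gm).
Qed.

(** * Sorting halves the cumulative degrees *)

Lemma cumdeg_seq_mnm {n : nat} (s : seq 'I_n) (t : nat) :
  cumdeg (seq_mnm s) t = count (fun i : 'I_n => i < t) s.
Proof.
rewrite /seq_mnm; elim: s => [|i s IHs]; first by rewrite big_nil cumdeg0.
by rewrite big_cons cumdegD cumdegU IHs.
Qed.

Lemma count_mnm_seq {n : nat} (m : 'X_{1..n}) (t : nat) :
  count (fun i : 'I_n => i < t) (mnm_seq m) = cumdeg m t.
Proof.
rewrite /mnm_seq /cumdeg count_flatten -map_comp sumnE big_map big_enum /=.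
rewrite [RHS]big_mkcond; apply: eq_bigr => i _ /=; rewrite count_nseq.
by case: ifP => _; rewrite ?mul1n ?mul0n.
Qed.

Lemma pairwise_mnm_seq {n : nat} (m : 'X_{1..n}) :
  pairwise (fun i j : 'I_n => i <= j) (mnm_seq m).
Proof.
have : pairwise (fun i j : 'I_n => i <= j) (enum 'I_n).
  rewrite -(pairwise_map val leq) val_enum_ord -sorted_pairwise; last exact: leq_trans.
  exact: iota_sorted.
rewrite /mnm_seq; elim: (enum 'I_n) => //= i s IHs /andP[/allP le_is /IHs ps].
rewrite pairwise_cat ps andbT; apply/andP; split.
  apply/allrelP => x y /nseqP[-> _] /flattenP[_ /mapP[j sj ->] /nseqP[-> _]].
  exact: le_is.
by elim: (m i) => //= p ->; rewrite andbT; apply/allP => x /nseqP[->].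
Qed.

(** The Boolean [b] tells whether the first letter is kept, so that both
    components of the sort are covered by one induction.  Letters below [t]
    come first: once a letter reaches [t], nothing is left to count. *)
Lemma count_alternating_mask {n : nat} (b : bool) (s : seq 'I_n) (t : nat) :
  pairwise (fun i j : 'I_n => i <= j) s ->
  count (fun i : 'I_n => i < t) (mask (mkseq (fun p => b (+) odd p) (size s)) s)
  = (count (fun i : 'I_n => i < t) s + b)./2.
Proof.
elim: s b => [|i s IHs] b; first by case: b.
rewrite pairwise_cons => /andP[/allP le_is ps].
have maskE : mkseq (fun p => b (+) odd p) (size (i :: s))
    = b :: mkseq (fun p => ~~ b (+) odd p) (size s).
  rewrite /mkseq /= addbF (iotaDl 1 0) -map_comp; congr (_ :: _).
  by apply: eq_map => p /=; rewrite addbN addNb.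
have {IHs} IHs := IHs (~~ b) ps.
have count0 : t <= i -> count (fun i : 'I_n => i < t) s = 0.
  move=> le_ti; apply/eqP; rewrite -leqn0 leqNgt -has_count.
  by apply/hasPn => j /le_is le_ij; rewrite -leqNgt (leq_trans le_ti).
rewrite maskE; case: b {maskE} IHs => /= ->; have [lt_it|/count0 ->] //= := ltnP i t;
  lia.
Qed.

Lemma cumdeg_sort1 {n : nat} (v w : 'X_{1..n}) (t : nat) :
  cumdeg (sort_pair v w).1 t = uphalf (cumdeg v t + cumdeg w t).
Proof.
rewrite cumdeg_seq_mnm -cumdegD -count_mnm_seq.
by rewrite (count_alternating_mask true) ?pairwise_mnm_seq // addn1.
Qed.

Lemma cumdeg_sort2 {n : nat} (v w : 'X_{1..n}) (t : nat) :
  cumdeg (sort_pair v w).2 t = (cumdeg v t + cumdeg w t)./2.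
Proof.
rewrite cumdeg_seq_mnm -cumdegD -count_mnm_seq.
by rewrite (count_alternating_mask false) ?pairwise_mnm_seq // addn0.
Qed.

Lemma sortable_dominating {n : nat} (k : nat) (u : 'X_{1..n}) :
  sortable_set (dominating k u).
Proof.
move=> v w [bv dv cv] [bw dw cw]; split; split.
- move=> i; have := cumdeg_sort1 v w i.+1; rewrite !cumdegS cumdeg_sort1.
  by have := bv i; have := bw i; lia.
- by rewrite -cumdeg_mdeg cumdeg_sort1 !cumdeg_mdeg dv dw; lia.
- by move=> t; rewrite cumdeg_sort1; have := cv t; have := cw t; lia.
- move=> i; have := cumdeg_sort2 v w i.+1; rewrite !cumdegS cumdeg_sort2.
  by have := bv i; have := bw i; lia.
- by rewrite -cumdeg_mdeg cumdeg_sort2 !cumdeg_mdeg dv dw; lia.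
- by move=> t; rewrite cumdeg_sort2; have := cv t; have := cw t; lia.
Qed.

Theorem theorem3p2 (K : fieldType) (n : nat) (hn : (3 <= n)%N)
    (k : nat) (hk : (0 < k)%N) (u : 'X_{1..n}) (hu : kbounded k u) :
  sortable_ideal (Bk K k u).
Proof.
have dD : equigenerated_in (mdeg u) (dominating k u) by move=> m [].
exists (dominating k u); first by rewrite (BkE K hu); apply: min_gens_mgen dD.
by split; [exists (mdeg u) | apply: sortable_dominating].
Qed.
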